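(* Let $n\ge 2$, $1\le p\le n/2$, and let $g_H$ be the generalized pp-wave metric $$g_H=2\,du^a\big(\delta_{ab}\,dv^b+H_{ab}\,du^b\big)+\delta_{AB}\,dx^A dx^B$$ defined by smooth functions $H_{ac}=H_{ca}=H_{ac}(x^A,u^b)$. For functions $h_{ac}=h_{ca}=h_{ac}(\varrho,x^A,u^b)$ (not depending on $v^1,\dots,v^p$) let $$\widetilde g_{H,h}=2\,d(\varrho t)\,dt+t^2\big(g_H+2h_{ac}\,du^a du^c\big).$$ Then $\widetilde g_{H,h}$ is Ricci-flat if and only if each of the functions $h_{bd}$ satisfies the linear second order PDE $$2\varrho\, h''_{bd}+(2-n)\,h'_{bd}-\Delta(H_{bd}+h_{bd})=0,$$ where the prime denotes differentiation with respect to $\varrho$. In particular, $\widetilde g_{H,h}$ is an ambient metric for the conformal class $[g_H]$ if, in addition, the initial conditions $h_{bd}(\varrho,x^A,u^b)|_{\varrho=0}=0$ are satisfied.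
   Context: Indices: $A,B\in\{1,\dots,n-2p\}$, $a,b,c,d\in\{1,\dots,p\}$, summation convention. Coordinates on an open set $\mathcal U\subset\mathbb R^n$ are $(x^1,\dots,x^{n-2p},u^1,\dots,u^p,v^1,\dots,v^p)$; products of one-forms are symmetric products; $\Delta=\delta^{AB}\partial_A\partial_B$ is the flat Laplacian in the $x^A$-variables. The metric $\widetilde g_{H,h}$ lives on $(0,\infty)\times\mathcal U\times(-\epsilon,\epsilon)$ with additional coordinates $t\in(0,\infty)$ and $\varrho\in(-\epsilon,\epsilon)$. An ambient metric for (the conformal class of) a metric $g_0$ is a metric of the form $2\,dt\,d(\varrho t)+t^2 g(x^i,\varrho)$ with $g(x^i,0)=g_0$ and with vanishing Ricci tensor. *)

(* Defs.v *)
From HB Require Import structures.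
From mathcomp Require Import all_boot all_order all_algebra.
From mathcomp Require Import all_classical all_reals all_analysis.

Set Implicit Arguments.
Unset Strict Implicit.
Unset Printing Implicit Defensive.

Import Order.TTheory GRing.Theory Num.Theory.
Import numFieldNormedType.Exports.

Local Open Scope classical_set_scope.
Local Open Scope ring_scope.

Section Regularity.
Context {R : realType} {V : normedModType R}.

(* C^k on an open set [W]. Derivatives are taken along every vector of [V]
   instead of along a basis; for the finite-dimensional [V] used below this is
   the usual class C^k. *)
Fixpoint Ck (k : nat) (W : set V) (f : V -> R) : Prop :=
  (forall z, W z -> {for z, continuous f}) /\
  if k is k'.+1 then
    forall v : V, (forall z, W z -> derivable f z v) /\ Ck k' W ('D_v f)
  else True.

(* Regularity classes: [Some k] stands for C^k and [None] for C^oo. *)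
Definition of_class (r : option nat) (W : set V) (f : V -> R) : Prop :=
  if r is Some k then Ck k W f else forall k, Ck k W f.

End Regularity.

Definition smooth {R : realType} {V : normedModType R} (W : set V) (f : V -> R)
  : Prop := of_class None W f.

Definition at_least_C2 (r : option nat) : bool :=
  if r is Some k then (2 <= k)%N else true.

Section CoordinateGeometry.
Context {R : realType} {m : nat}.
Implicit Types (f : 'rV[R]_m -> R) (g : 'rV[R]_m -> 'M[R]_m) (W : set 'rV[R]_m).

Definition partial (i : 'I_m) f : 'rV[R]_m -> R := 'D_(delta_mx 0 i) f.

Definition dcoord (i : 'I_m) : 'rV[R]_m := delta_mx 0 i.

Definition dform f (z : 'rV[R]_m) : 'rV[R]_m := \row_i partial i f z.

(* Symmetric product of one-forms, normalized by [symprod a a = a (x) a]. *)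
Definition symprod (alpha beta : 'rV[R]_m) : 'M[R]_m :=
  2^-1 *: (alpha^T *m beta + beta^T *m alpha).

Definition is_metric (r : option nat) W g : Prop :=
  (forall i j, of_class r W (fun z => g z i j)) /\
  (forall z, W z -> (g z)^T = g z /\ g z \in unitmx).

(* [christoffel g k i j] is Gamma^k_(ij), and the Ricci tensor is
   R_(ij) = d_k Gamma^k_(ij) - d_j Gamma^k_(ik)
            + Gamma^k_(kl) Gamma^l_(ij) - Gamma^k_(jl) Gamma^l_(ik). *)
Definition christoffel g (k i j : 'I_m) (z : 'rV[R]_m) : R :=
  2^-1 * \sum_(l < m) invmx (g z) k l *
    (partial i (fun y => g y j l) z + partial j (fun y => g y i l) z
     - partial l (fun y => g y i j) z).

Definition ricci g (i j : 'I_m) (z : 'rV[R]_m) : R :=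
  \sum_(k < m) (partial k (christoffel g k i j) z
                - partial j (christoffel g k i k) z)
  + \sum_(k < m) \sum_(l < m)
      (christoffel g k k l z * christoffel g l i j z
       - christoffel g k j l z * christoffel g l i k z).

Definition ricci_flat W g : Prop :=
  forall z, W z -> forall i j, ricci g i j z = 0.

Definition laplacian f (x : 'rV[R]_m) : R :=
  \sum_(i < m) partial i (partial i f) x.

End CoordinateGeometry.

Notation "alpha ⊙ beta" := (symprod alpha beta)
  (at level 40, left associativity) : ring_scope.

Section Ambient.
Context {R : realType} {m : nat}.

(* Coordinates (t, y, rho) on the ambient space, with y ranging over the base. *)
Definition amb_t (z : 'rV[R]_(1 + (m + 1))) : R := z 0 (lshift _ ord0).
Definition amb_base (z : 'rV[R]_(1 + (m + 1))) : 'rV[R]_m := lsubmx (rsubmx z).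
Definition amb_rho (z : 'rV[R]_(1 + (m + 1))) : R :=
  z 0 (rshift 1 (rshift m ord0)).

Definition amb_domain (U : set 'rV[R]_m) (eps : R) : set 'rV[R]_(1 + (m + 1)) :=
  [set z | 0 < amb_t z /\ U (amb_base z) /\ - eps < amb_rho z < eps].

(* A bilinear form on the base, seen as a form on the ambient space. *)
Definition amb_pull (B : 'M[R]_m) : 'M[R]_(1 + (m + 1)) :=
  block_mx 0 0 0 (block_mx B 0 0 0).

(* 2 dt d(rho t) + t^2 g(y, rho). *)
Definition amb_form (g : R -> 'rV[R]_m -> 'M[R]_m) (z : 'rV[R]_(1 + (m + 1)))
  : 'M[R]_(1 + (m + 1)) :=
  2 *: (dform (fun w => amb_rho w * amb_t w) z ⊙ dform amb_t z)
  + amb_t z ^+ 2 *: amb_pull (g (amb_rho z) (amb_base z)).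

Definition ambient_metric (r : option nat) (U : set 'rV[R]_m) (eps : R)
    (g0 : 'rV[R]_m -> 'M[R]_m)
    (gt : 'rV[R]_(1 + (m + 1)) -> 'M[R]_(1 + (m + 1))) : Prop :=
  [/\ is_metric r (amb_domain U eps) gt,
      exists2 g : R -> 'rV[R]_m -> 'M[R]_m,
        forall z, amb_domain U eps z -> gt z = amb_form g z
        & forall y, U y -> g 0 y = g0 y
    & ricci_flat (amb_domain U eps) gt].

End Ambient.

Section PPWave.
Context {R : realType} {q p : nat}.

(* Coordinates (x^1..x^q, u^1..u^p, v^1..v^p) on the base. *)
Definition ix (A : 'I_q) : 'I_(q + (p + p)) := lshift (p + p) A.
Definition iu (a : 'I_p) : 'I_(q + (p + p)) := rshift q (lshift p a).
Definition iv (a : 'I_p) : 'I_(q + (p + p)) := rshift q (rshift p a).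

Definition xpart (y : 'rV[R]_(q + (p + p))) : 'rV[R]_q := lsubmx y.
Definition upart (y : 'rV[R]_(q + (p + p))) : 'rV[R]_p := lsubmx (rsubmx y).

Definition dx (A : 'I_q) : 'rV[R]_(q + (p + p)) := dcoord (ix A).
Definition du (a : 'I_p) : 'rV[R]_(q + (p + p)) := dcoord (iu a).
Definition dv (a : 'I_p) : 'rV[R]_(q + (p + p)) := dcoord (iv a).

(* The (x, u)-values of the points of [U]: the domain of functions on [U] that
   do not depend on v. *)
Definition xu_proj (U : set 'rV[R]_(q + (p + p))) : set ('rV[R]_q * 'rV[R]_p) :=
  [set (xpart y, upart y) | y in U].

Definition gH (H : 'I_p -> 'I_p -> 'rV[R]_q -> 'rV[R]_p -> R)
    (y : 'rV[R]_(q + (p + p))) : 'M[R]_(q + (p + p)) :=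
  2 *: (\sum_(a < p) du a ⊙
          (\sum_(b < p) ((a == b)%:R *: dv b
                         + H a b (xpart y) (upart y) *: du b)))
  + \sum_(A < q) \sum_(B < q) (A == B)%:R *: (dx A ⊙ dx B).

Definition gHh (H : 'I_p -> 'I_p -> 'rV[R]_q -> 'rV[R]_p -> R)
    (h : 'I_p -> 'I_p -> R -> 'rV[R]_q -> 'rV[R]_p -> R)
    : 'rV[R]_(1 + ((q + (p + p)) + 1)) -> 'M[R]_(1 + ((q + (p + p)) + 1)) :=
  amb_form (fun rho y =>
    gH H y
    + 2 *: (\sum_(a < p) \sum_(c < p)
              h a c rho (xpart y) (upart y) *: (du a ⊙ du c))).

End PPWave.

(* With q = n - 2p and p <= n/2, the base coordinates are those of R^n. *)
Lemma base_dimE (n p : nat) : (p.*2 <= n)%N -> (n - p.*2 + (p + p))%N = n.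
Proof. by move=> le_pn; rewrite addnn subnK. Qed.

(* Main.v *)
(* Order the ambient coordinates as (t, x, u, v, rho). The metric has constant
   coefficients up to powers of [t], except for [g_tt = 2 rho] and
   [g_(u^a u^b) = t^2 phi_ab] with [phi = 2 (H + h)]. As [phi] is independent of
   [t] and [v], and the inverse metric has no [du]-block, no product of two
   derivatives of [phi] survives in the Ricci tensor, which is therefore affine
   in [phi]. Its trace terms only involve [d log t], everything without [phi]
   cancels because the case [phi = 0] is flat, and the only remaining components
   are
     R_(u^b u^d) = rho phi'' + (2 - n)/2 phi' - 1/2 Delta phi,
   that is, the left-hand side of the PDE. Since [phi] factors through the
   linear projection to (rho, x, u), partial derivatives upstairs are
   directional derivatives of [H] and [h], so no chain rule is needed. *)
Require Import Defs.
From HB Require Import structures.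
From mathcomp Require Import all_boot all_order all_algebra.
From mathcomp Require Import all_classical all_reals all_analysis.
From mathcomp Require Import ring.

Set Implicit Arguments.
Unset Strict Implicit.
Unset Printing Implicit Defensive.

Import Order.TTheory GRing.Theory Num.Theory.
Import numFieldNormedType.Exports.

Local Open Scope classical_set_scope.
Local Open Scope ring_scope.

(** * Directional derivatives and regularity classes *)

Section DirectionalDerivatives.
Context {R : realType} {V : normedModType R}.
Implicit Types (f g : V -> R) (z v : V) (a b : R).

Lemma is_derive_add f g z v a b : is_derive z v f a -> is_derive z v g b ->
  is_derive z v (fun y => f y + g y) (a + b).
Proof. by move=> fa gb; exact: is_deriveD. Qed.

Lemma is_derive_sub f g z v a b : is_derive z v f a -> is_derive z v g b ->
  is_derive z v (fun y => f y - g y) (a - b).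
Proof. by move=> fa gb; exact: is_deriveB. Qed.

Lemma is_derive_opp f z v a : is_derive z v f a ->
  is_derive z v (fun y => - f y) (- a).
Proof. by move=> fa; exact: is_deriveN. Qed.

Lemma is_derive_mul f g z v a b : is_derive z v f a -> is_derive z v g b ->
  is_derive z v (fun y => f y * g y) (f z * b + g z * a).
Proof. by move=> fa gb; exact: is_deriveM. Qed.

Lemma is_derive_inv f z v a : f z != 0 -> is_derive z v f a ->
  is_derive z v (fun y => (f y)^-1) (- (f z) ^- 2 * a).
Proof.
by move=> fz [fd <-]; apply: DeriveDef; [exact: derivableV | rewrite deriveV].
Qed.

Lemma is_derive_const a z v : is_derive z v (fun=> a) 0.
Proof. exact: is_derive_cst. Qed.

(** Every difference quotient along [v] is identically zero, so the limit exists and is zero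
    whatever the regularity of [f]. *)
Lemma is_derive_invariant f z v : (forall a y, f (a *: v + y) = f y) ->
  is_derive z v f 0.
Proof.
move=> fv.
have E : (fun a : R => a^-1 *: ((f \o shift z) (a *: v) - f z)) = cst 0.
  by apply/funext => a /=; rewrite fv subrr scaler0.
have c0 : (cst 0 : R -> R) @ 0^' --> (0 : R) by exact: cvg_cst.
by apply: DeriveDef; rewrite ?/derivable ?/derive E;
  [apply/cvg_ex; exists 0 | exact: cvg_lim c0].
Qed.

Lemma derive_invariant f v : (forall a y, f (a *: v + y) = f y) ->
  'D_v f = cst 0.
Proof. by move=> fv; apply/funext => z; have [] := is_derive_invariant z fv. Qed.

(** Translating the base point by a multiple of [v] leaves each difference quotient along [w]
    unchanged. This carries the invariance of the wave profile over to its first derivatives. *)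
Lemma derive_invariantP f v w : (forall a y, f (a *: v + y) = f y) ->
  forall a y, 'D_w f (a *: v + y) = 'D_w f y.
Proof.
move=> fv a y; rewrite /derive (_ : (fun b : R => _) =
  (fun b => b^-1 *: ((f \o shift y) (b *: w) - f y)))//.
by apply/funext => b /=; rewrite addrCA !fv.
Qed.

End DirectionalDerivatives.

(** * Comparison of difference quotients on different spaces *)

Section AlongLinearMaps.
Context {R : realType} {V V' : normedModType R}.
Implicit Types (f : V -> R).

(** Equal increments give the same difference quotients, hence literally the same limit expression,
    whether or not that limit exists. This turns directional derivatives on the ambient space into
    derivatives in a single block of variables. *)
Lemma eq_derive_increment f (f' : V' -> R) (z v : V) (z' v' : V') :
  (forall a, f (a *: v + z) - f z = f' (a *: v' + z') - f' z') ->
  'D_v f z = 'D_v' f' z'.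
Proof.
move=> ff'; rewrite /derive (_ : (fun a : R => _) =
  (fun a => a^-1 *: ((f' \o shift z') (a *: v') - f' z')))//.
by apply/funext => a /=; rewrite ff'.
Qed.

Variable L : {linear V' -> V}.

(** By linearity the quotient of [f \o L] at [z] along [v] is the quotient of [f] at [L z] along
    [L v], so this chain rule asks no differentiability of [f]. *)
Lemma derive_comp_linear f z v : 'D_v (f \o L) z = 'D_(L v) f (L z).
Proof.
rewrite /derive (_ : (fun a : R => _) =
  (fun a => a^-1 *: ((f \o shift (L z)) (a *: L v) - f (L z))))//.
by apply/funext => a /=; rewrite linearP.
Qed.

Lemma derivable_comp_linear f z v :
  derivable (f \o L) z v = derivable f (L z) (L v).
Proof.
rewrite /derivable (_ : (fun a : R => _) =
  (fun a => a^-1 *: ((f \o shift (L z)) (a *: L v) - f (L z))))//.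
by apply/funext => a /=; rewrite linearP.
Qed.

End AlongLinearMaps.

(** * Locality and closure properties of the classes C^k *)

Section RegularityClasses.
Context {R : realType} {V : normedModType R}.
Implicit Types (f g : V -> R) (W : set V) (r : option nat).

(** Regularity on an open set is local: functions equal on [W] agree near each of its points, so
    their derivatives agree on [W] too and the induction proceeds. It lets the sum and product
    rules, valid only on [W], replace a derivative. *)
Lemma Ck_ext k W f g : open W -> (forall z, W z -> f z = g z) ->
  Ck k W f -> Ck k W g.
Proof.
move=> Wo; have near_W z (P : set V) : W z -> (forall y, W y -> P y) ->
    \forall y \near z, P y.
  by move=> Wz WP; apply: filterS WP _; exact: open_nbhs_nbhs.
have ext_cont f0 g0 : (forall z, W z -> f0 z = g0 z) ->
    (forall z, W z -> {for z, continuous f0}) ->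
    forall z, W z -> {for z, continuous g0}.
  move=> fg fc z Wz; rewrite /prop_for /continuous_at -fg//.
  by apply: cvg_trans (fc z Wz); exact/near_eq_cvg/near_W.
elim: k f g => [|k IH] f g fg [fc fd]; split=> //; try exact: ext_cont fg fc.
move=> v; have [dv Dv] := fd v; split=> [z Wz|].
  by apply: near_eq_derivable (dv z Wz); exact: near_W.
apply: IH Dv => z Wz; exact/near_eq_derive/near_W.
Qed.

Lemma Ck_sub k W W' f : W' `<=` W -> Ck k W f -> Ck k W' f.
Proof.
move=> W'W; elim: k f => [|k IH] f [fc fd]; split=> //; try by move=> z /W'W/fc.
by move=> v; have [dv Dv] := fd v; split; [move=> z /W'W/dv | exact: IH].
Qed.

Lemma Ck_pred k W f : Ck k.+1 W f -> Ck k W f.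
Proof.
elim: k f => [|k IH] f [fc fd]; split=> // v.
by have [dv Dv] := fd v; split=> //; exact: IH.
Qed.

Lemma Ck_le k l W f : (k <= l)%N -> Ck l W f -> Ck k W f.
Proof.
by move=> /subnK <-; elim: (l - k)%N => [//|d IH] /Ck_pred.
Qed.

Lemma Ck_const k W (a : R) : Ck k W (fun=> a).
Proof.
elim: k a => [|k IH] a; split=> //; try by move=> z _; exact: cvg_cst.
move=> v; split=> [z _|]; first exact: derivable_cst.
rewrite (_ : 'D_v _ = fun=> 0); first exact: IH.
by apply/funext => z; rewrite derive_cst.
Qed.

Lemma Ck_add k W f g : open W -> Ck k W f -> Ck k W g ->
  Ck k W (fun z => f z + g z).
Proof.
move=> Wo; elim: k f g => [|k IH] f g [fc fd] [gc gd]; split=> //.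
- by move=> z Wz; apply: continuousD; [exact: fc | exact: gc].
- by move=> z Wz; apply: continuousD; [exact: fc | exact: gc].
move=> v; have [df Df] := fd v; have [dg Dg] := gd v; split=> [z Wz|].
  by apply: derivableD; [exact: df | exact: dg].
apply: Ck_ext (IH _ _ Df Dg) => // z Wz.
by rewrite [RHS]deriveD//; [exact: df | exact: dg].
Qed.

Lemma Ck_mul k W f g : open W -> Ck k W f -> Ck k W g ->
  Ck k W (fun z => f z * g z).
Proof.
move=> Wo; elim: k f g => [|k IH] f g Cf Cg.
  case: Cf => [fc fd]; case: Cg => [gc gd]; split=> //.
  by move=> z Wz; apply: continuousM; [exact: fc | exact: gc].
(* The Leibniz rule multiplies a derivative, of class C^k, by an undifferentiated factor, which must
   be lowered from C^(k+1) to C^k for the induction hypothesis. *)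
have [f0 g0] := (Ck_pred Cf, Ck_pred Cg).
case: Cf => [fc fd]; case: Cg => [gc gd]; split=> //.
  by move=> z Wz; apply: continuousM; [exact: fc | exact: gc].
move=> v; have [df Df] := fd v; have [dg Dg] := gd v; split=> [z Wz|].
  by apply: derivableM; [exact: df | exact: dg].
apply: Ck_ext (Ck_add Wo (IH _ _ f0 Dg) (IH _ _ g0 Df)) => // z Wz.
by rewrite [RHS]deriveM//; [exact: df | exact: dg].
Qed.

Lemma of_class_Ck k r W f : (if r is Some l then (k <= l)%N else true) ->
  of_class r W f -> Ck k W f.
Proof. by case: r => [l|] /= kl; [exact: Ck_le | apply]. Qed.

Lemma smooth_of_class r W f : smooth W f -> of_class r W f.
Proof. by case: r => [k|] //= sf; exact: sf. Qed.

Lemma of_class_sub r W W' f : W' `<=` W -> of_class r W f -> of_class r W' f.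
Proof.
by case: r => [k|] W'W /=; [exact: Ck_sub | move=> fC k; exact: Ck_sub (fC k)].
Qed.

Lemma of_class_const r W a : of_class r W (fun=> a).
Proof. by case: r => [k|] => [|k]; exact: Ck_const. Qed.

Lemma of_class_add r W f g : open W -> of_class r W f -> of_class r W g ->
  of_class r W (fun z => f z + g z).
Proof.
by move=> Wo; case: r => [k|] /= Cf Cg => [|k]; apply: Ck_add => //.
Qed.

Lemma of_class_mul r W f g : open W -> of_class r W f -> of_class r W g ->
  of_class r W (fun z => f z * g z).
Proof.
by move=> Wo; case: r => [k|] /= Cf Cg => [|k]; apply: Ck_mul => //.
Qed.

Lemma Ck_is_derive k W f z v : Ck k.+1 W f -> W z -> is_derive z v f ('D_v f z).
Proof. by move=> [_ /(_ v)[df _]] Wz; exact/derivableP/df. Qed.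

Lemma Ck_derive k W f v : Ck k.+1 W f -> Ck k W ('D_v f).
Proof. by move=> [_ /(_ v)[]]. Qed.

End RegularityClasses.

Section RegularityLinear.
Context {R : realType} {V V' : normedModType R} (L : {linear V' -> V}).
Hypothesis L_continuous : continuous L.
Implicit Types (f : V -> R) (W : set V).

Lemma Ck_comp_linear k W f : Ck k W f -> Ck k (L @^-1` W) (f \o L).
Proof.
elim: k f => [|k IH] f [fc fd]; split=> //.
- by move=> z Wz; apply: continuous_comp; [exact: L_continuous | exact: fc].
- by move=> z Wz; apply: continuous_comp; [exact: L_continuous | exact: fc].
move=> v; have [df Df] := fd (L v); split=> [z Wz|].
  by rewrite derivable_comp_linear; exact: df.
rewrite (_ : 'D_v _ = 'D_(L v) f \o L); first exact: IH.
by apply/funext => z; rewrite derive_comp_linear.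
Qed.

Lemma of_class_comp_linear r W f :
  of_class r W f -> of_class r (L @^-1` W) (f \o L).
Proof.
by case: r => [k|] /= Cf => [|k]; exact: Ck_comp_linear.
Qed.

End RegularityLinear.

Section Linear.
Context {R : realType} {V : normedModType R} (f : {linear V -> R^o}).

Lemma is_derive_linear z v : is_derive z v f (f v).
Proof.
apply: DeriveDef.
  (* A scalar linear map is the identity of the line composed with itself, so its derivative is that
     of the identity along [f v]. *)
  have := @derivable_id R R^o (f z) (f v).
  by rewrite -[derivable _ _ _](derivable_comp_linear f idfun).
transitivity ('D_(f v) (@idfun R^o) (f z)); last exact: derive_id.
exact: (derive_comp_linear f idfun).
Qed.

Lemma of_class_linear r (W : set V) : continuous f -> of_class r W f.
Proof.
move=> fc; suff C k : Ck k W f by case: r => [k|] => [|k]; exact: C.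
case: k => [|k]; split=> //; try by move=> z _; exact: fc.
move=> v; split=> [z _|]; first by have [] := is_derive_linear z v.
rewrite (_ : 'D_v f = fun=> f v); first exact: Ck_const.
by apply/funext => z; have [] := is_derive_linear z v.
Qed.

End Linear.

(** * The Ricci tensor as a table over coordinate types *)

(** Ambient indices by kind (t, x, u, v, rho), so that tensor components can be given by pattern
    matching and checked by case analysis instead of by nested block shifts. *)
Inductive ambidx (q p : nat) : Type :=
  | IT | IX of 'I_q | IU of 'I_p | IV of 'I_p | IR.
Arguments IT {q p}. Arguments IX {q p}. Arguments IU {q p}.
Arguments IV {q p}. Arguments IR {q p}.

(** * Finite sums against Kronecker deltas *)

Section Kronecker.
Context {K : realFieldType}.

Lemma sum_kronecker n (i : 'I_n) (F : 'I_n -> K) :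
  \sum_j (i == j)%:R * F j = F i.
Proof.
rewrite (bigD1 i)//= eqxx mul1r big1 ?addr0// => j ji.
by rewrite eq_sym (negPf ji) mul0r.
Qed.

Lemma sum_kronecker_sym n (i : 'I_n) (F : 'I_n -> K) :
  \sum_j (j == i)%:R * F j = F i.
Proof. by rewrite -[RHS]sum_kronecker; under eq_bigr do rewrite eq_sym. Qed.

Lemma sum_mul0 n (F : 'I_n -> K) : \sum_j 0 * F j = 0.
Proof. by rewrite big1// => j _; rewrite mul0r. Qed.

Lemma sum_mulr0 n (F : 'I_n -> K) : \sum_j F j * 0 = 0.
Proof. by rewrite big1// => j _; rewrite mulr0. Qed.

Lemma sum2_mul0 m n (F : 'I_m -> 'I_n -> K) : \sum_i \sum_j 0 * F i j = 0.
Proof. by rewrite big1// => i _; rewrite sum_mul0. Qed.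

Lemma sum2_mulr0 m n (F : 'I_m -> 'I_n -> K) : \sum_i \sum_j F i j * 0 = 0.
Proof. by rewrite big1// => i _; rewrite sum_mulr0. Qed.

Lemma sum_pull n (c : K) (x F : 'I_n -> K) :
  \sum_a (c * x a) * F a = c * \sum_a x a * F a.
Proof. by rewrite mulr_sumr; apply: eq_bigr => a _; ring. Qed.

Lemma sum_pull2N n (c d : K) (x F : 'I_n -> K) :
  \sum_a - (c * (d * x a)) * F a = - (c * d * \sum_a x a * F a).
Proof. by rewrite mulr_sumr -sumrN; apply: eq_bigr => a _; ring. Qed.

Lemma sum2_pull m n (c : K) (x F : 'I_m -> 'I_n -> K) :
  \sum_i \sum_a (c * x i a) * F i a = c * \sum_i \sum_a x i a * F i a.
Proof. by rewrite mulr_sumr; apply: eq_bigr => i _; rewrite sum_pull. Qed.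

Lemma sum2_pullN m n (c : K) (x F : 'I_m -> 'I_n -> K) :
  \sum_i \sum_a - (c * x i a) * F i a = - (c * \sum_i \sum_a x i a * F i a).
Proof.
by rewrite -sum2_pull -sumrN; apply: eq_bigr => i _; rewrite -sumrN;
  apply: eq_bigr => a _; ring.
Qed.

Lemma sum_delta_sym n (c : K) (i : 'I_n) (F : 'I_n -> K) :
  \sum_a (a == i)%:R * c * F a = c * F i.
Proof.
by rewrite -(sum_kronecker_sym i) mulr_sumr; apply: eq_bigr => a _; ring.
Qed.

Lemma sum_deltaN n (i : 'I_n) (F : 'I_n -> K) :
  \sum_a - (i == a)%:R * F a = - F i.
Proof. by rewrite -(sum_kronecker i F) -sumrN; apply: eq_bigr => a _; ring. Qed.

Lemma sum2_delta n (c : K) (F : 'I_n -> 'I_n -> K) :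
  \sum_i \sum_a (i == a)%:R * c * F a i = c * \sum_a F a a.
Proof.
rewrite mulr_sumr; apply: eq_bigr => i _.
by under eq_bigr do rewrite -mulrA; rewrite sum_kronecker.
Qed.

End Kronecker.

(** * Christoffel symbols and Ricci tensor as pointwise algebra *)

Section CoordinateTables.
Context {K : realFieldType} {q p : nat}.
Local Notation idx := (ambidx q p).
Implicit Types (i j k l m : idx).

Definition sum_idx (F : idx -> K) : K :=
  F IT + \sum_A F (IX A) + \sum_a F (IU a) + \sum_a F (IV a) + F IR.

Lemma eq_sum_idx (F G : idx -> K) : F =1 G -> sum_idx F = sum_idx G.
Proof. by move=> FG; congr sum_idx; apply/funext. Qed.

Definition d_t k : K := if k is IT then 1 else 0.
Definition d_rho k : K := if k is IR then 1 else 0.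

(* [dphi k] and [ddphi k l] stand for the partial derivatives [d_k phi] and
   [d_k d_l phi] at a point, so that the curvature becomes plain algebra. *)
Variables (t rho : K) (phi : 'I_p -> 'I_p -> K).
Variables (dphi : idx -> 'I_p -> 'I_p -> K).
Variables (ddphi : idx -> idx -> 'I_p -> 'I_p -> K).

Definition metric_tab i j : K :=
  match i, j with
  | IT, IT => 2 * rho
  | IT, IR | IR, IT => t
  | IX A, IX B => t ^+ 2 * (A == B)%:R
  | IU a, IU b => t ^+ 2 * phi a b
  | IU a, IV b | IV a, IU b => t ^+ 2 * (a == b)%:R
  | _, _ => 0
  end.

Definition dmetric_tab k i j : K :=
  match i, j with
  | IT, IT => 2 * d_rho k
  | IT, IR | IR, IT => d_t k
  | IX A, IX B => 2 * t * d_t k * (A == B)%:R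
  | IU a, IU b => 2 * t * d_t k * phi a b + t ^+ 2 * dphi k a b
  | IU a, IV b | IV a, IU b => 2 * t * d_t k * (a == b)%:R
  | _, _ => 0
  end.

(** The metric splits into three blocks: (t, rho), x, and (u, v). The corner [- (2 * rho / t ^+ 2)]
    and the v-v block [- phi / t ^+ 2] come from inverting the first and the last, each of which has
    a zero lower right corner. *)
Definition inverse_tab i j : K :=
  match i, j with
  | IT, IR | IR, IT => t^-1
  | IR, IR => - (2 * rho / t ^+ 2)
  | IX A, IX B => (A == B)%:R * t ^- 2
  | IU a, IV b | IV a, IU b => (a == b)%:R * t ^- 2
  | IV a, IV b => - (phi a b * t ^- 2)
  | _, _ => 0
  end.

(** The upper index comes first. The vanishing of the t- and v-derivatives of [phi] is already built
    in. *)
Definition christoffel_tab k i j : K :=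
  match k, i, j with
  | IT, IU a, IU b => - (2^-1 * (t * dphi IR a b))
  | IR, IT, IR | IR, IR, IT => t^-1
  | IR, IX A, IX B => - (A == B)%:R
  | IR, IU a, IV b | IR, IV a, IU b => - (a == b)%:R
  | IR, IU a, IU b => rho * dphi IR a b - phi a b
  | IX A, IT, IX B | IX A, IX B, IT => (A == B)%:R * t^-1
  | IX A, IU a, IU b => - (2^-1 * dphi (IX A) a b)
  | IU a, IT, IU b | IU a, IU b, IT => (a == b)%:R * t^-1
  | IV a, IT, IV b | IV a, IV b, IT => (a == b)%:R * t^-1
  | IV a, IU b, IR | IV a, IR, IU b => 2^-1 * dphi IR a b
  | IV a, IU b, IX A | IV a, IX A, IU b => 2^-1 * dphi (IX A) a b
  | IV a, IU b, IU c =>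
      2^-1 * (dphi (IU b) a c + dphi (IU c) a b - dphi (IU a) b c)
  | _, _, _ => 0
  end.

(** The derivative of [christoffel_tab] along coordinate [m], with [ddphi m] for the derivative of
    [dphi]. Constant symbols, such as those with upper index rho and a Kronecker delta, fall into
    the default case. *)
Definition dchristoffel_tab m k i j : K :=
  match k, i, j with
  | IT, IU a, IU b =>
      - (2^-1 * (t * ddphi m IR a b + dphi IR a b * d_t m))
  | IR, IT, IR | IR, IR, IT => - t ^- 2 * d_t m
  | IR, IU a, IU b =>
      rho * ddphi m IR a b + dphi IR a b * d_rho m - dphi m a b
  | IX A, IT, IX B | IX A, IX B, IT => (A == B)%:R * (- t ^- 2 * d_t m)
  | IX A, IU a, IU b => - (2^-1 * ddphi m (IX A) a b)
  | IU a, IT, IU b | IU a, IU b, IT => (a == b)%:R * (- t ^- 2 * d_t m)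
  | IV a, IT, IV b | IV a, IV b, IT => (a == b)%:R * (- t ^- 2 * d_t m)
  | IV a, IU b, IR | IV a, IR, IU b => 2^-1 * ddphi m IR a b
  | IV a, IU b, IX A | IV a, IX A, IU b => 2^-1 * ddphi m (IX A) a b
  | IV a, IU b, IU c =>
      2^-1 * (ddphi m (IU b) a c + ddphi m (IU c) a b - ddphi m (IU a) b c)
  | _, _, _ => 0
  end.

Definition ricci_tab i j : K :=
  match i, j with
  | IU b, IU d => rho * ddphi IR IR b d
      + 2^-1 * (2 - (q + (p + p))%:R) * dphi IR b d
      - 2^-1 * \sum_A ddphi (IX A) (IX A) b d
  | _, _ => 0
  end.

Hypothesis t_neq0 : t != 0.
Hypothesis phi_sym : forall a b, phi a b = phi b a.
Hypothesis dphi_sym : forall k a b, dphi k a b = dphi k b a.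
Hypothesis dphi_T : forall a b, dphi IT a b = 0.
Hypothesis dphi_V : forall c a b, dphi (IV c) a b = 0.
Hypothesis ddphi_T : forall k a b, ddphi IT k a b = 0.
Hypothesis ddphi_V : forall c k a b, ddphi (IV c) k a b = 0.

Definition sum_zero :=
  (@sum_mul0 K, @sum_mulr0 K, @sum2_mul0 K, @sum2_mulr0 K,
   @big1_eq K 0 +%R, mul0r, mulr0, add0r, addr0).

Lemma inverse_row k (F : idx -> K) :
  sum_idx (fun l => inverse_tab k l * F l) =
  match k with
  | IT => t^-1 * F IR
  | IR => t^-1 * F IT - 2 * rho / t ^+ 2 * F IR
  | IX A => t ^- 2 * F (IX A)
  | IU a => t ^- 2 * F (IV a)
  | IV a => t ^- 2 * F (IU a) - t ^- 2 * \sum_b phi a b * F (IV b)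
  end.
Proof.
rewrite /sum_idx; case: k => [|A|a|a|] /=; rewrite ?sum_zero//.
- by under eq_bigr do rewrite -mulrA; rewrite sum_kronecker.
- by under eq_bigr do rewrite -mulrA; rewrite sum_kronecker.
- under eq_bigr do rewrite -mulrA; rewrite sum_kronecker; congr (_ + _).
  by rewrite mulr_sumr -sumrN; apply: eq_bigr => b _; ring.
- by rewrite mulNr.
Qed.

(** The v-row of the metric is [t ^+ 2] times a constant and no coefficient depends on v, so only
    the t-derivative of the du-dv coefficient survives. *)
Lemma first_kind_IV i j a :
  dmetric_tab i j (IV a) + dmetric_tab j i (IV a) - dmetric_tab (IV a) i j =
  match i, j with
  | IT, IU b | IU b, IT => (b == a)%:R * (2 * t)
  | _, _ => 0
  end.
Proof.
by case: i => [|B|b|b|]; case: j => [|C|c|c|] /=; rewrite ?dphi_V; ring.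
Qed.

Lemma christoffel_tabE k i j :
  2^-1 * sum_idx (fun l => inverse_tab k l *
    (dmetric_tab i j l + dmetric_tab j i l - dmetric_tab l i j)) =
  christoffel_tab k i j.
Proof.
rewrite inverse_row; case: k => [|A|a|a|].
- by case: i => [|B|b|b|]; case: j => [|C|c|c|] /=; field.
- by case: i => [|B|b|b|]; case: j => [|C|c|c|] /=;
    rewrite 1?(eq_sym B A) 1?(eq_sym C A); field.
- by rewrite first_kind_IV; case: i => [|B|b|b|]; case: j => [|C|c|c|] /=;
    rewrite 1?(eq_sym b a) 1?(eq_sym c a); field.
(* Raising to an upper v-index also uses the v-v block of the inverse. Its term in [phi] cancels the
   t-derivative of the u-u coefficient, so the symbol with lower indices t and u vanishes. *)
- under eq_bigr do rewrite first_kind_IV mulrC.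
  by case: i => [|B|b|b|]; case: j => [|C|c|c|] /=;
    try under eq_bigr do rewrite -mulrA;
    rewrite ?(sum_kronecker, sum_zero, dphi_T, dphi_V);
    rewrite 1?(phi_sym b a) 1?(phi_sym c a) 1?(eq_sym b a) 1?(eq_sym c a);
    rewrite 1?(dphi_sym _ b a) 1?(dphi_sym _ c a); field.
- by case: i => [|B|b|b|]; case: j => [|C|c|c|] /=; rewrite ?dphi_T; field.
Qed.

Lemma sum_idxB (F G : idx -> K) :
  sum_idx (fun k => F k - G k) = sum_idx F - sum_idx G.
Proof. by rewrite /sum_idx !sumrB; ring. Qed.

Lemma sum_idx_trace (c : K) :
  sum_idx (fun k => if k is IT then 0 else c) = (q + (p + p) + 1)%:R * c.
Proof.
by rewrite /sum_idx !sumr_const !card_ord -!(mulr_natl c) !natrD; ring.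
Qed.

(** The contraction is the derivative of log sqrt |det g|, and |det g| is a power of t independent
    of [phi]. Here each diagonal symbol already has this shape, before summation. *)
Lemma christoffel_trace k l :
  christoffel_tab k k l = if k is IT then 0 else t^-1 * d_t l.
Proof.
by case: k => [|A|a|a|]; case: l => [|B|b|b|] //=;
  rewrite ?eqxx ?mul1r ?mulr1 ?mulr0.
Qed.

Lemma dchristoffel_trace m k i :
  dchristoffel_tab m k i k = if k is IT then 0 else - t ^- 2 * d_t m * d_t i.
Proof.
by case: k => [|A|a|a|]; case: i => [|B|b|b|] //=;
  rewrite ?eqxx ?mul1r ?mulr1 ?mulr0.
Qed.

(** In the u-u case the term [- 2^-1 * dphi IR] comes from the factor t in the symbol with upper
    index t. The first-order terms with upper index rho cancel, since differentiating
    [rho * dphi IR - phi] leaves only [rho * ddphi IR IR]. *)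
Lemma dchristoffel_divergence i j :
  sum_idx (fun k => dchristoffel_tab k k i j) =
  match i, j with
  | IU b, IU d => rho * ddphi IR IR b d - 2^-1 * dphi IR b d
      - 2^-1 * \sum_A ddphi (IX A) (IX A) b d
  | _, _ => 0
  end.
Proof.
have sum0 n (F : 'I_n -> K) : (forall a, F a = 0) -> \sum_a F a = 0.
  by move=> F0; rewrite big1.
rewrite /sum_idx; case: i => [|B|b|b|]; case: j => [|C|c|c|] /=;
  rewrite ?sum_zero ?ddphi_T;
  try by rewrite ?sum0 // => *; rewrite ?ddphi_V; ring.
rewrite [\sum_(a < p) _]sum0 => [|a]; last by rewrite !ddphi_V; ring.
by rewrite sumrN -mulr_sumr; field.
Qed.

(** Keeping the second factor an arbitrary array [F] allows the quadratic curvature term to be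
    expanded one factor at a time, using the sparsity of each in turn. *)
Lemma christoffel_row j (F : idx -> idx -> K) :
  sum_idx (fun k => sum_idx (fun l => christoffel_tab k j l * F l k)) =
  match j with
  | IT => t^-1 * (\sum_A F (IX A) (IX A) + \sum_a F (IU a) (IU a)
            + \sum_a F (IV a) (IV a) + F IR IR)
  | IX A => t^-1 * F IT (IX A) - F (IX A) IR
            + 2^-1 * \sum_a \sum_b dphi (IX A) a b * F (IU b) (IV a)
  | IU c => t^-1 * F IT (IU c) - F (IV c) IR
            - 2^-1 * t * \sum_b dphi IR c b * F (IU b) IT
            + \sum_b (rho * dphi IR c b - phi c b) * F (IU b) IR
            - 2^-1 * \sum_A \sum_b dphi (IX A) c b * F (IU b) (IX A)
            + 2^-1 * \sum_a dphi IR a c * F IR (IV a)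
            + 2^-1 * \sum_a \sum_A dphi (IX A) a c * F (IX A) (IV a)
            + 2^-1 * \sum_a \sum_b
                (dphi (IU c) a b + dphi (IU b) a c - dphi (IU a) c b) *
                F (IU b) (IV a)
  | IV a => t^-1 * F IT (IV a) - F (IU a) IR
  | IR => t^-1 * F IT IR
          + 2^-1 * \sum_a \sum_b dphi IR a b * F (IU b) (IV a)
  end.
Proof.
rewrite /sum_idx; case: j => [|C|c|c|] /=;
  rewrite !big_split /= ?sum_zero.
- by rewrite !sum2_delta; ring.
- by rewrite sum_delta_sym sum_deltaN sum2_pull; ring.
- rewrite sum_delta_sym sum_deltaN !sum_pull2N sum2_pullN !sum2_pull.
  by rewrite sum_pull; ring.
- by rewrite sum_delta_sym sum_deltaN; ring.
- by rewrite sum2_pull; ring.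
Qed.

Lemma ricci_tabE i j :
  sum_idx (fun k => dchristoffel_tab k k i j - dchristoffel_tab j k i k)
  + sum_idx (fun k => sum_idx (fun l =>
      christoffel_tab k k l * christoffel_tab l i j
      - christoffel_tab k j l * christoffel_tab l i k)) = ricci_tab i j.
Proof.
have trace : sum_idx (fun k => sum_idx (fun l =>
    christoffel_tab k k l * christoffel_tab l i j)) =
  (q + (p + p) + 1)%:R * (t^-1 * christoffel_tab IT i j).
  rewrite -sum_idx_trace; congr sum_idx; apply/funext => k.
  have -> : (fun l => christoffel_tab k k l * christoffel_tab l i j) =
      fun l => (if k is IT then 0 else t^-1 * d_t l) * christoffel_tab l i j.
    by apply/funext => l; rewrite christoffel_trace.
  by case: k => [|A|a|a|]; rewrite /sum_idx /= ?sum_zero ?mulr1 ?sum_zero.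
have dtrace : sum_idx (fun k => dchristoffel_tab j k i k) =
    (q + (p + p) + 1)%:R * (- t ^- 2 * d_t j * d_t i).
  rewrite -sum_idx_trace; congr sum_idx; apply/funext => k.
  exact: dchristoffel_trace.
have -> : (fun k => sum_idx (fun l =>
      christoffel_tab k k l * christoffel_tab l i j
      - christoffel_tab k j l * christoffel_tab l i k)) =
    fun k => sum_idx (fun l => christoffel_tab k k l * christoffel_tab l i j)
      - sum_idx (fun l => christoffel_tab k j l * christoffel_tab l i k).
  by apply/funext => k; rewrite sum_idxB.
rewrite !sum_idxB dchristoffel_divergence dtrace trace.
rewrite (christoffel_row j (fun l k => christoffel_tab l i k)).
case: i {trace dtrace} => [|B|b|b|]; case: j => [|C|c|c|] /=;
  rewrite ?(sum_zero, oppr0, subr0) //.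
(* The t-t component: the derivative of the trace and the quadratic term are both n+1 copies of
   [t ^- 2], with opposite signs. *)
- under eq_bigr do rewrite eqxx mul1r.
  under [\sum_(a < p) _]eq_bigr do rewrite eqxx mul1r.
  by rewrite !sumr_const !card_ord -!(mulr_natl t^-1) !natrD; field.
(* The u-u component: the quadratic term consists of four copies of -1/2 phi'. Subtracting it gives
   +2, the divergence gives -1/2 and the trace -(n+1)/2, in total (2-n)/2. *)
- have -> : \sum_a dphi IR c a * ((a == b)%:R / t) = t^-1 * dphi IR b c.
    by under eq_bigr do rewrite mulrC; rewrite sum_delta_sym dphi_sym.
  have -> : \sum_a dphi IR a c * - (b == a)%:R = - dphi IR b c.
    by under eq_bigr do rewrite mulrC; rewrite sum_deltaN.
  by rewrite (dphi_sym _ c b) !natrD; field.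
Qed.

End CoordinateTables.

(** * Ambient coordinates *)

Section AmbientIndices.
Context {q p : nat}.
Local Notation m := (q + (p + p))%N.

Definition ord_of (k : ambidx q p) : 'I_(1 + (m + 1)) :=
  match k with
  | IT => lshift _ ord0
  | IX A => rshift 1 (lshift 1 (ix A))
  | IU a => rshift 1 (lshift 1 (iu a))
  | IV a => rshift 1 (lshift 1 (iv a))
  | IR => rshift 1 (rshift m ord0)
  end.

Definition idx_of (i : 'I_(1 + (m + 1))) : ambidx q p :=
  match fintype.split i with
  | inl _ => IT
  | inr j => match fintype.split j with
    | inr _ => IR
    | inl y => match fintype.split y with
      | inl A => IX A
      | inr w => match fintype.split w with inl a => IU a | inr a => IV a end
      end
    end
  end.

Lemma ord_ofK : cancel ord_of idx_of.
Proof.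
have sl n1 n2 (i : 'I_n1) : fintype.split (lshift n2 i) = inl i.
  exact: unsplitK (inl i).
have sr n1 n2 (i : 'I_n2) : fintype.split (rshift n1 i) = inr i.
  exact: unsplitK (inr i).
by rewrite /idx_of; case=> [|A|a|a|] /=; rewrite ?(sl, sr).
Qed.

Lemma idx_ofK : cancel idx_of ord_of.
Proof.
move=> i; rewrite /idx_of; case: (split_ordP i) => [j ->|j ->] /=.
  by rewrite (ord1 j).
case: (split_ordP j) => [y ->|y ->] /=; last by rewrite (ord1 y).
by case: (split_ordP y) => [A ->|w ->] //=; case: (split_ordP w) => [a ->|a ->].
Qed.

Lemma sum_ord_of {K : realFieldType} (F : 'I_(1 + (m + 1)) -> K) :
  \sum_i F i = sum_idx (fun k => F (ord_of k)).
Proof. by rewrite !big_split_ord !big_ord1 /sum_idx /= !addrA. Qed.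

Lemma eq_ord_of k l : (ord_of k == ord_of l) =
  match k, l with
  | IT, IT | IR, IR => true
  | IX A, IX B => A == B
  | IU a, IU b | IV a, IV b => a == b
  | _, _ => false
  end.
Proof.
by case: k => [|A|a|a|]; case: l => [|B|b|b|]; rewrite /= ?eq_shift ?eqxx.
Qed.

End AmbientIndices.

(** * Coordinate projections as continuous linear maps, and the coordinate directions *)

Section AmbientCoordinates.
Context {R : realType} {q p : nat}.
Local Notation m := (q + (p + p))%N.
Local Notation point := 'rV[R]_(1 + (m + 1)).

Definition amb_x (z : point) : 'rV[R]_q := xpart (amb_base z).
Definition amb_u (z : point) : 'rV[R]_p := upart (amb_base z).

Definition amb_xu (z : point) : 'rV[R]_q * 'rV[R]_p := (amb_x z, amb_u z).

(** The projection through which all wave coefficients factor. Its kernel contains the t- and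
    v-directions. *)
Definition amb_rxu (z : point) : R * ('rV[R]_q * 'rV[R]_p) :=
  (amb_rho z, amb_xu z).

Fact amb_t_linear : linear (amb_t : point -> R^o).
Proof. by move=> a y z; rewrite /amb_t !mxE. Qed.
HB.instance Definition _ :=
  GRing.isLinear.Build R point R^o *:%R (amb_t : point -> R^o) amb_t_linear.

Fact amb_rho_linear : linear (amb_rho : point -> R^o).
Proof. by move=> a y z; rewrite /amb_rho !mxE. Qed.
HB.instance Definition _ :=
  GRing.isLinear.Build R point R^o *:%R (amb_rho : point -> R^o) amb_rho_linear.

Fact amb_x_linear : linear amb_x.
Proof. by move=> a y z; rewrite /amb_x /xpart /amb_base !linearP. Qed.
HB.instance Definition _ :=
  GRing.isLinear.Build R point _ *:%R amb_x amb_x_linear.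

Fact amb_u_linear : linear amb_u.
Proof. by move=> a y z; rewrite /amb_u /upart /amb_base !linearP. Qed.
HB.instance Definition _ :=
  GRing.isLinear.Build R point _ *:%R amb_u amb_u_linear.

Fact amb_xu_linear : linear amb_xu.
Proof. by move=> a y z; rewrite /amb_xu !linearP. Qed.
HB.instance Definition _ :=
  GRing.isLinear.Build R point _ *:%R amb_xu amb_xu_linear.

Fact amb_rxu_linear : linear amb_rxu.
Proof. by move=> a y z; rewrite /amb_rxu !linearP. Qed.
HB.instance Definition _ :=
  GRing.isLinear.Build R point _ *:%R amb_rxu amb_rxu_linear.

Lemma continuous_amb_t : continuous (amb_t : point -> R).
Proof. exact: coord_continuous. Qed.

Lemma continuous_amb_rho : continuous (amb_rho : point -> R).
Proof. exact: coord_continuous. Qed.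

Lemma continuous_amb_base : continuous (amb_base : point -> 'rV[R]_m).
Proof.
move=> z; apply: continuous_comp; first exact: continuous_rsubmx.
exact: continuous_lsubmx.
Qed.

Lemma continuous_amb_xu : continuous amb_xu.
Proof.
have cx : continuous amb_x.
  move=> z; apply: continuous_comp; first exact: continuous_amb_base.
  exact: continuous_lsubmx.
have cu : continuous amb_u.
  move=> z; apply: continuous_comp; first exact: continuous_amb_base.
  apply: continuous_comp; first exact: continuous_rsubmx.
  exact: continuous_lsubmx.
by move=> z; exact: (cvg_pair (cx z) (cu z)).
Qed.

Lemma continuous_amb_rxu : continuous amb_rxu.
Proof.
by move=> z; exact: (cvg_pair (@continuous_amb_rho z) (@continuous_amb_xu z)).
Qed.

Lemma open_amb_domain (U : set 'rV[R]_m) eps :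
  open U -> open (amb_domain U eps).
Proof.
move=> Uo; rewrite (_ : amb_domain U eps =
  [set z : point | 0 < amb_t z] `&` (amb_base @^-1` U `&`
    ([set z | - eps < amb_rho z] `&` [set z | amb_rho z < eps]))); last first.
  apply/seteqP; split=> z /=.
    by move=> [? [? /andP[]]].
  by move=> [? [? [? ?]]]; split=> //; split=> //; apply/andP.
apply: openI.
  by apply: (@open_comp _ _ amb_t [set a | 0 < a]) => [z _|];
    [exact: continuous_amb_t | exact: open_gt].
apply: openI; first by apply: open_comp Uo => z _; exact: continuous_amb_base.
apply: openI.
  by apply: (@open_comp _ _ amb_rho [set a | - eps < a]) => [z _|];
    [exact: continuous_amb_rho | exact: open_gt].
by apply: (@open_comp _ _ amb_rho [set a | a < eps]) => [z _|];
  [exact: continuous_amb_rho | exact: open_lt].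
Qed.

Definition amb_dir (k : ambidx q p) : point := delta_mx 0 (ord_of k).

Lemma amb_dirE k l : amb_dir k 0 (ord_of l) = (ord_of l == ord_of k)%:R.
Proof. by rewrite mxE. Qed.

Lemma amb_t_dir k : amb_t (amb_dir k) = d_t k.
Proof.
by rewrite /amb_t [LHS](amb_dirE k IT) eq_ord_of /d_t; case: k.
Qed.

Lemma amb_rho_dir k : amb_rho (amb_dir k) = d_rho k.
Proof.
by rewrite /amb_rho [LHS](amb_dirE k IR) eq_ord_of /d_rho; case: k.
Qed.

Lemma amb_x_dir k : amb_x (amb_dir k) = if k is IX A then delta_mx 0 A else 0.
Proof.
apply/rowP => B; rewrite !mxE [rshift _ _ == _](eq_ord_of (IX B) k).
by case: k => [|A|a|a|]; rewrite !mxE.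
Qed.

Lemma amb_u_dir k : amb_u (amb_dir k) = if k is IU a then delta_mx 0 a else 0.
Proof.
apply/rowP => b; rewrite !mxE [rshift _ _ == _](eq_ord_of (IU b) k).
by case: k => [|A|a|a|]; rewrite !mxE.
Qed.

Lemma amb_rxu_dir_T : amb_rxu (amb_dir IT) = 0.
Proof. by rewrite /amb_rxu /amb_xu amb_rho_dir amb_x_dir amb_u_dir. Qed.

Lemma amb_rxu_dir_V c : amb_rxu (amb_dir (IV c)) = 0.
Proof. by rewrite /amb_rxu /amb_xu amb_rho_dir amb_x_dir amb_u_dir. Qed.

End AmbientCoordinates.

(** * The metric and its curvature *)

Section WaveMetric.
Context {R : realType} {q p : nat}.
Local Notation m := (q + (p + p))%N.
Local Notation point := 'rV[R]_(1 + (m + 1)).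
Variables (H : 'I_p -> 'I_p -> 'rV[R]_q -> 'rV[R]_p -> R).
Variables (h : 'I_p -> 'I_p -> R -> 'rV[R]_q -> 'rV[R]_p -> R).
Local Notation g := (gHh H h).
Local Notation du := (@du R q p).
Local Notation dv := (@dv R q p).
Local Notation dx := (@dx R q p).

Definition H_amb a b (z : point) : R := H a b (amb_x z) (amb_u z).
Definition h_amb a b (z : point) : R := h a b (amb_rho z) (amb_x z) (amb_u z).

(* The [du^a du^b] coefficient of the metric divided by [t^2], symmetrized since
   the symmetry of [H] and [h] is only known on the domain. *)
Definition phi a b (z : point) : R :=
  H_amb a b z + H_amb b a z + (h_amb a b z + h_amb b a z).

Lemma symprodE n (alpha beta : 'rV[R]_n) i j :
  symprod alpha beta i j = 2^-1 * (alpha 0 i * beta 0 j + beta 0 i * alpha 0 j).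
Proof. by rewrite !mxE !big_ord1 !mxE. Qed.

Lemma dcoordE n (i j : 'I_n) : dcoord i 0 j = (j == i)%:R :> R.
Proof. by rewrite mxE. Qed.

(** The bilinear form with u-u block [F], not symmetrized; twice a symmetric product yields it
    together with its transpose. *)
Definition du_form (F : 'I_p -> 'I_p -> R) (i j : 'I_m) : R :=
  \sum_a du a 0 i * \sum_b du b 0 j * F a b.

Lemma gHE (y : 'rV[R]_m) i j : gH H y i j =
  \sum_a du a 0 i * dv a 0 j + \sum_a du a 0 j * dv a 0 i
  + du_form (fun a b => H a b (xpart y) (upart y)) i j
  + du_form (fun a b => H a b (xpart y) (upart y)) j i
  + \sum_A dx A 0 i * dx A 0 j.
Proof.
have w a (l : 'I_m) :
    (\sum_b ((a == b)%:R *: dv b + H a b (xpart y) (upart y) *: du b)) 0 l =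
    dv a 0 l + \sum_b du b 0 l * H a b (xpart y) (upart y) :> R.
  rewrite summxE; under eq_bigr do rewrite mxE [X in X + _]mxE [X in _ + X]mxE.
  rewrite big_split /= sum_kronecker; congr (_ + _).
  by apply: eq_bigr => b _; rewrite mulrC.
rewrite /gH mxE summxE; congr (_ + _).
  rewrite mxE summxE mulr_sumr -!big_split /=; apply: eq_bigr => a _.
  by rewrite symprodE !w; field.
apply: eq_bigr => A _; rewrite summxE; under eq_bigr do rewrite mxE symprodE.
by rewrite sum_kronecker; field.
Qed.

Lemma h_formE (F : 'I_p -> 'I_p -> R) i j :
  (2 *: \sum_a \sum_c F a c *: symprod (du a) (du c)) i j =
  du_form F i j + du_form F j i.
Proof.
rewrite mxE summxE mulr_sumr -big_split /=; apply: eq_bigr => a _.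
rewrite summxE !mulr_sumr -big_split /=; apply: eq_bigr => c _.
by rewrite mxE symprodE; field.
Qed.

Lemma sum_du (F : 'I_p -> R) :
  [/\ forall A, \sum_a du a 0 (ix A) * F a = 0,
      forall c, \sum_a du a 0 (iu c) * F a = F c
    & forall c, \sum_a du a 0 (iv c) * F a = 0].
Proof.
split=> c; last 1 first; last 1 first.
- under eq_bigr do rewrite dcoordE !eq_shift.
  exact: sum_kronecker.
- by rewrite big1// => a _; rewrite dcoordE !eq_shift mul0r.
- by rewrite big1// => a _; rewrite dcoordE !eq_shift mul0r.
Qed.

Lemma dvE a :
  [/\ forall A, dv a 0 (ix A) = 0 :> R,
      forall c, dv a 0 (iu c) = 0
    & forall c, dv a 0 (iv c) = (c == a)%:R].
Proof. by split=> c; rewrite dcoordE !eq_shift. Qed.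

Lemma sum_dx (F : 'I_q -> R) :
  [/\ forall A, \sum_B dx B 0 (ix A) * F B = F A,
      forall c, \sum_B dx B 0 (iu c) * F B = 0
    & forall c, \sum_B dx B 0 (iv c) * F B = 0].
Proof.
split=> c.
- under eq_bigr do rewrite dcoordE !eq_shift.
  exact: sum_kronecker.
- by rewrite big1// => a _; rewrite dcoordE !eq_shift mul0r.
- by rewrite big1// => a _; rewrite dcoordE !eq_shift mul0r.
Qed.

Lemma dform_rho_t (z : point) k :
  dform (fun w => amb_rho w * amb_t w) z 0 (ord_of k) =
  amb_rho z * d_t k + amb_t z * d_rho k.
Proof.
rewrite mxE -amb_t_dir -amb_rho_dir /partial.
have [_ ->//] := is_derive_mul (is_derive_linear amb_rho z (amb_dir k))
  (is_derive_linear amb_t z (amb_dir k)).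
Qed.

Lemma dform_t (z : point) k : dform amb_t z 0 (ord_of k) = d_t k.
Proof.
rewrite mxE -amb_t_dir /partial.
by have [_ ->//] := is_derive_linear amb_t z (amb_dir k).
Qed.

(** Since [phi] is symmetrized by construction, this holds at every point, also off the domain. It
    is therefore an equality of functions, which may be differentiated directly. *)
Lemma gHhE (z : point) k l :
  g z (ord_of k) (ord_of l) =
  metric_tab (amb_t z) (amb_rho z) (fun a b => phi a b z) k l.
Proof.
rewrite /gHh /amb_form mxE [X in X + _ = _]mxE symprodE !dform_rho_t !dform_t.
rewrite [X in _ + X = _]mxE /amb_pull.
have du_ix F A : \sum_a du a 0 (ix A) * F a = 0 by have [] := sum_du F.
have du_iu F c : \sum_a du a 0 (iu c) * F a = F c by have [] := sum_du F.
have du_iv F c : \sum_a du a 0 (iv c) * F a = 0 by have [] := sum_du F.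
have dx_ix F A : \sum_B dx B 0 (ix A) * F B = F A by have [] := sum_dx F.
have dx_iu F c : \sum_B dx B 0 (iu c) * F B = 0 by have [] := sum_dx F.
have dx_iv F c : \sum_B dx B 0 (iv c) * F B = 0 by have [] := sum_dx F.
have dv_ix a A : dv a 0 (ix A) = 0 by have [] := dvE a.
have dv_iu a c : dv a 0 (iu c) = 0 by have [] := dvE a.
have dv_iv a c : dv a 0 (iv c) = (c == a)%:R by have [] := dvE a.
have mx0E n1 n2 (i : 'I_n1) (j : 'I_n2) : (0 : 'M[R]_(n1, n2)) i j = 0.
  by rewrite mxE.
case: k => [|A|a|a|]; case: l => [|B|b|b|];
  rewrite /= ?(block_mxEul, block_mxEur, block_mxEdl, block_mxEdr);
  rewrite ?mx0E.
all: try by field.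
all: rewrite [(gH _ _ + _) _ _]mxE gHE h_formE.
all: rewrite /du_form.
all: rewrite ?(du_ix, du_iu, du_iv, dx_ix, dx_iu, dx_iv, dv_ix, dv_iu, dv_iv).
all: rewrite ?[dx _ _ _]dcoordE ?eq_shift.
all: try by rewrite /phi /H_amb /h_amb /amb_x /amb_u /=; field.
all: by rewrite [in RHS]eq_sym; field.
Qed.

Lemma mulmx_inverse_tab (z : point) : amb_t z != 0 ->
  (\matrix_(i, j) inverse_tab (amb_t z) (amb_rho z) (fun a b => phi a b z)
      (idx_of i) (idx_of j)) *m g z = 1%:M.
Proof.
move=> t0; apply/matrixP => i j; rewrite -(idx_ofK i) -(idx_ofK j).
move: (idx_of i) (idx_of j) => k l {i j}; rewrite mxE sum_ord_of.
under eq_sum_idx do rewrite mxE !ord_ofK gHhE.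
rewrite inverse_row mxE eq_ord_of.
case: k => [|A|a|a|]; case: l => [|B|b|b|] /=;
  rewrite ?sum_zero; try by field.
(* The remaining entry is in row v and column u, where the two contributions of [phi] cancel. *)
under eq_bigr do rewrite mulrA mulrC.
by rewrite sum_kronecker_sym; field.
Qed.

Lemma gHh_unit (z : point) : amb_t z != 0 -> g z \in unitmx.
Proof. by move=> /mulmx_inverse_tab /mulmx1_unit[]. Qed.

Lemma invmx_gHh (z : point) k l : amb_t z != 0 ->
  invmx (g z) (ord_of k) (ord_of l) =
  inverse_tab (amb_t z) (amb_rho z) (fun a b => phi a b z) k l.
Proof.
move=> t0; have := mulmx_inverse_tab t0; set B := \matrix_(_, _) _ => Bg.
have -> : invmx (g z) = B.
  by rewrite -[LHS]mul1mx -Bg -mulmxA mulmxV ?mulmx1// gHh_unit.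
by rewrite mxE !ord_ofK.
Qed.

Lemma gHh_sym (z : point) : (g z)^T = g z.
Proof.
apply/matrixP => i j; rewrite mxE -(idx_ofK i) -(idx_ofK j) !gHhE.
case: (idx_of i) => [|A|a|a|]; case: (idx_of j) => [|B|b|b|] //=;
  rewrite 1?eq_sym // /phi; ring.
Qed.

End WaveMetric.
Lemma is_derive_sqr {R : realType} {V : normedModType R} (f : V -> R) z v a :
  is_derive z v f a -> is_derive z v (fun y => f y ^+ 2) (2 * f z * a).
Proof.
move=> fa; apply: is_derive_eq (is_derive_mul fa fa) _; ring.
Qed.

(** * The tables as the actual derivatives and curvature of the metric *)

Section WaveCurvature.
Context {R : realType} {q p : nat}.
Local Notation m := (q + (p + p))%N.
Local Notation point := 'rV[R]_(1 + (m + 1)).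
Variables (H : 'I_p -> 'I_p -> 'rV[R]_q -> 'rV[R]_p -> R).
Variables (h : 'I_p -> 'I_p -> R -> 'rV[R]_q -> 'rV[R]_p -> R).
Variables (W : set point).
Hypothesis W_open : open W.
Hypothesis W_t : forall z, W z -> amb_t z != 0.
Hypothesis phi_C2 : forall a b, Ck 2 W (phi H h a b).
Local Notation g := (gHh H h).

Definition dphi (k : ambidx q p) a b : point -> R :=
  'D_(amb_dir k) (phi H h a b).
Definition ddphi (l k : ambidx q p) a b : point -> R :=
  'D_(amb_dir l) (dphi k a b).

Lemma phi_sym a b z : phi H h a b z = phi H h b a z.
Proof. by rewrite /phi; ring. Qed.

Lemma dphi_sym k a b : dphi k a b = dphi k b a.
Proof.
by rewrite /dphi (_ : phi H h a b = phi H h b a)//;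
  apply/funext => z; exact: phi_sym.
Qed.

Lemma phi_invariant a b v : amb_rxu v = 0 ->
  forall (s : R) y, phi H h a b (s *: v + y) = phi H h a b y.
Proof.
move=> v0 s y; have : amb_rxu (s *: v + y) = amb_rxu y.
  by rewrite amb_rxu_linear v0 scaler0 add0r.
by rewrite /phi /H_amb /h_amb => -[-> -> ->].
Qed.

Lemma dphi_T a b : dphi IT a b = cst 0.
Proof. exact/derive_invariant/phi_invariant/amb_rxu_dir_T. Qed.

Lemma dphi_V c a b : dphi (IV c) a b = cst 0.
Proof. exact/derive_invariant/phi_invariant/amb_rxu_dir_V. Qed.

Lemma ddphi_T k a b : ddphi IT k a b = cst 0.
Proof.
exact/derive_invariant/derive_invariantP/phi_invariant/amb_rxu_dir_T.
Qed.

Lemma ddphi_V c k a b : ddphi (IV c) k a b = cst 0.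
Proof.
exact/derive_invariant/derive_invariantP/phi_invariant/amb_rxu_dir_V.
Qed.

Section AtPoint.
Variable (z : point).
Hypothesis Wz : W z.
Variable (l : ambidx q p).

Let isd_t : is_derive z (amb_dir l) (amb_t : point -> R) (d_t l).
Proof. by rewrite -amb_t_dir; exact: is_derive_linear. Qed.

Let isd_rho : is_derive z (amb_dir l) (amb_rho : point -> R) (d_rho l).
Proof. by rewrite -amb_rho_dir; exact: is_derive_linear. Qed.

Let isd_phi a b : is_derive z (amb_dir l) (phi H h a b) (dphi l a b z).
Proof. exact: Ck_is_derive (phi_C2 a b) Wz. Qed.

Let isd_dphi k a b : is_derive z (amb_dir l) (dphi k a b) (ddphi l k a b z).
Proof. exact: Ck_is_derive (Ck_derive (amb_dir k) (phi_C2 a b)) Wz. Qed.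

Let isd_tV : is_derive z (amb_dir l) (fun y : point => (amb_t y)^-1)
  (- amb_t z ^- 2 * d_t l).
Proof. by apply: is_derive_inv; [exact: W_t | exact: isd_t]. Qed.

(** Differentiates by the outermost operation, leaving the derivative to unification so that only an
    algebraic identity remains. Subtraction is tried before addition because it is itself a sum. *)
Local Ltac isd := cbv beta; lazymatch goal with
  | |- is_derive _ _ (fun y => @?f y - @?g y) _ =>
      notypeclasses refine (is_derive_sub _ _); isd
  | |- is_derive _ _ (fun y => @?f y + @?g y) _ =>
      notypeclasses refine (is_derive_add _ _); isd
  | |- is_derive _ _ (fun y => - @?f y) _ =>
      notypeclasses refine (is_derive_opp _); isd
  | |- is_derive _ _ (fun y => @?f y * @?g y) _ =>
      notypeclasses refine (is_derive_mul _ _); isd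
  | |- is_derive _ _ (fun y => @?f y ^+ 2) _ =>
      notypeclasses refine (is_derive_sqr _); isd
  | |- is_derive _ _ (fun y => (amb_t y)^-1) _ => exact: isd_tV
  | |- is_derive _ _ (fun y => amb_t y) _ => exact: isd_t
  | |- is_derive _ _ (fun y => amb_rho y) _ => exact: isd_rho
  | |- is_derive _ _ (fun y => phi _ _ _ _ y) _ => exact: isd_phi
  | |- is_derive _ _ (fun y => dphi _ _ _ y) _ => exact: isd_dphi
  | |- is_derive _ _ amb_t _ => exact: isd_t
  | |- is_derive _ _ amb_rho _ => exact: isd_rho
  | |- is_derive _ _ (phi _ _ _ _) _ => exact: isd_phi
  | |- is_derive _ _ (dphi _ _ _) _ => exact: isd_dphi
  | |- is_derive _ _ (fun=> _) _ => exact: is_derive_const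
  end.

(* [ring] compares atoms up to conversion, which is prohibitive on
   derivatives. *)
Local Ltac abstract_ring := rewrite /=;
  repeat match goal with |- context [?f z] => generalize (f z); intro end; ring.

Lemma is_derive_metric_tab i j :
  is_derive z (amb_dir l)
    (fun y => metric_tab (amb_t y) (amb_rho y) (fun a b => phi H h a b y) i j)
    (dmetric_tab (amb_t z) (fun a b => phi H h a b z)
      (fun k a b => dphi k a b z) l i j).
Proof.
by case: i => [|A|a|a|]; case: j => [|B|b|b|] /=;
  (notypeclasses refine (is_derive_eq _ _); [isd | abstract_ring]).
Qed.

Lemma is_derive_christoffel_tab k i j :
  is_derive z (amb_dir l)
    (fun y => christoffel_tab (amb_t y) (amb_rho y)
      (fun a b => phi H h a b y) (fun k a b => dphi k a b y) k i j)
    (dchristoffel_tab (amb_t z) (amb_rho z) (fun k a b => dphi k a b z)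
      (fun l k a b => ddphi l k a b z) l k i j).
Proof.
by case: k => [|C|c|c|]; case: i => [|A|a|a|]; case: j => [|B|b|b|] /=;
  (notypeclasses refine (is_derive_eq _ _); [isd | abstract_ring]).
Qed.

End AtPoint.

Lemma christoffel_gHh z k i j : W z ->
  christoffel g (ord_of k) (ord_of i) (ord_of j) z =
  christoffel_tab (amb_t z) (amb_rho z) (fun a b => phi H h a b z)
    (fun k a b => dphi k a b z) k i j.
Proof.
move=> Wz.
have partial_g l i' j' :
    partial (ord_of l) (fun y => g y (ord_of i') (ord_of j')) z =
    dmetric_tab (amb_t z) (fun a b => phi H h a b z)
      (fun k a b => dphi k a b z) l i' j'.
  rewrite (_ : (fun y => _) = fun y => metric_tab (amb_t y) (amb_rho y)
    (fun a b => phi H h a b y) i' j'); last by apply/funext => y; exact: gHhE.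
  by have [_] := is_derive_metric_tab Wz l i' j'.
rewrite /christoffel sum_ord_of -christoffel_tabE.
- by congr (_ * _); apply: eq_sum_idx => l; rewrite !partial_g invmx_gHh ?W_t.
- exact: W_t.
- by move=> a b; exact: phi_sym.
- by move=> *; rewrite dphi_sym.
- by move=> a b; rewrite dphi_T.
- by move=> c a b; rewrite dphi_V.
Qed.

Lemma ricci_gHh z i j : W z -> ricci g (ord_of i) (ord_of j) z =
  ricci_tab (amb_rho z) (fun k a b => dphi k a b z)
    (fun l k a b => ddphi l k a b z) i j.
Proof.
move=> Wz.
have partial_christoffel l k i' j' :
    partial (ord_of l) (christoffel g (ord_of k) (ord_of i') (ord_of j')) z =
    dchristoffel_tab (amb_t z) (amb_rho z) (fun k a b => dphi k a b z)
      (fun l k a b => ddphi l k a b z) l k i' j'.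
  have [_ <-] := is_derive_christoffel_tab Wz l k i' j'.
  (* The Christoffel symbols are identified with the table on [W] only; as [W] is open, this
     determines their derivatives at [z]. *)
  apply: near_eq_derive; near=> y; apply: christoffel_gHh; near: y.
  exact: open_nbhs_nbhs.
rewrite /ricci !sum_ord_of.
rewrite -(@ricci_tabE _ _ _ (amb_t z) (amb_rho z) (fun a b => phi H h a b z)).
- congr (_ + _); apply: eq_sum_idx => k; rewrite ?partial_christoffel//.
  by rewrite sum_ord_of; apply: eq_sum_idx => l; rewrite !christoffel_gHh.
- exact: W_t.
- by move=> k a b; rewrite dphi_sym.
- by move=> k a b; rewrite ddphi_T.
- by move=> c k a b; rewrite ddphi_V.
Unshelve. all: by end_near. Qed.

End WaveCurvature.

(** * The u-u Ricci components as the wave operator on [H] and [h] *)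

Section WaveOperator.
Context {R : realType} {q p : nat}.
Local Notation m := (q + (p + p))%N.
Local Notation point := 'rV[R]_(1 + (m + 1)).
Variables (H : 'I_p -> 'I_p -> 'rV[R]_q -> 'rV[R]_p -> R).
Variables (h : 'I_p -> 'I_p -> R -> 'rV[R]_q -> 'rV[R]_p -> R).
Implicit Types (b d : 'I_p) (y z : point).

Definition Hh_amb b d z : R := H_amb H b d z + h_amb h b d z.

(** Moving in the rho-direction changes only the rho-argument of [h], and [H] drops out of the
    increment. The identity holds at every point, so the same argument applies once more for the
    second derivative. *)
Lemma derive_rho_Hh b d z :
  'D_(amb_dir IR) (Hh_amb b d) z =
  derive1 (fun s => h b d s (amb_x z) (amb_u z)) (amb_rho z).
Proof.
rewrite derive1E; apply: eq_derive_increment => s.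
rewrite /Hh_amb /H_amb /h_amb !linearP /= amb_rho_dir amb_x_dir amb_u_dir.
by rewrite !scaler0 !add0r /d_rho; ring.
Qed.

Lemma derive2_rho_Hh b d z :
  'D_(amb_dir IR) ('D_(amb_dir IR) (Hh_amb b d)) z =
  derive1n 2 (fun s => h b d s (amb_x z) (amb_u z)) (amb_rho z).
Proof.
rewrite /derive1n /= [RHS]derive1E; apply: eq_derive_increment => s.
rewrite !derive_rho_Hh !linearP /= amb_rho_dir amb_x_dir amb_u_dir.
by rewrite !scaler0 !add0r.
Qed.

Lemma derive_x_Hh b d A z :
  'D_(amb_dir (IX A)) (Hh_amb b d) z =
  partial A (fun x => H b d x (amb_u z) + h b d (amb_rho z) x (amb_u z))
    (amb_x z).
Proof.
apply: eq_derive_increment => s.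
rewrite /Hh_amb /H_amb /h_amb !linearP /= amb_rho_dir amb_x_dir amb_u_dir.
by rewrite !scaler0 !add0r.
Qed.

Lemma derive2_x_Hh b d A z :
  'D_(amb_dir (IX A)) ('D_(amb_dir (IX A)) (Hh_amb b d)) z =
  partial A (partial A
    (fun x => H b d x (amb_u z) + h b d (amb_rho z) x (amb_u z))) (amb_x z).
Proof.
apply: eq_derive_increment => s.
rewrite !derive_x_Hh !linearP /= amb_rho_dir amb_x_dir amb_u_dir.
by rewrite !scaler0 !add0r.
Qed.

Variable (W : set point).
Hypothesis W_open : open W.
Hypothesis Hh_C2 : forall b d, Ck 2 W (Hh_amb b d).
Hypothesis Hh_sym : forall b d z, W z -> Hh_amb b d z = Hh_amb d b z.

Lemma phi_Hh b d z : W z -> phi H h b d z = 2 * Hh_amb b d z.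
Proof.
move=> Wz; rewrite mulrDl mul1r {2}Hh_sym// /phi /Hh_amb; ring.
Qed.

Lemma dphi_Hh k b d z : W z ->
  dphi H h k b d z = 2 * 'D_(amb_dir k) (Hh_amb b d) z.
Proof.
move=> Wz; rewrite -[2 * _]deriveZ; last first.
  by have [] := Ck_is_derive (amb_dir k) (Hh_C2 b d) Wz.
apply: near_eq_derive; near=> y; apply: phi_Hh; near: y.
exact: open_nbhs_nbhs.
Unshelve. all: by end_near. Qed.

Lemma ddphi_Hh k b d z : W z -> ddphi H h k k b d z =
  2 * 'D_(amb_dir k) ('D_(amb_dir k) (Hh_amb b d)) z.
Proof.
move=> Wz; rewrite -[2 * _]deriveZ; last first.
  by have [] := Ck_is_derive (amb_dir k) (Ck_derive (amb_dir k) (Hh_C2 b d)) Wz.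
apply: near_eq_derive; near=> y; apply: dphi_Hh; near: y.
exact: open_nbhs_nbhs.
Unshelve. all: by end_near. Qed.

(** On [W] the symmetry of [H + h] gives [phi = 2 (H + h)]; this factor 2 absorbs the halves in
    [ricci_tab] and produces the [2 * rho] of the PDE. *)
Lemma ricci_tab_Hh b d z : W z ->
  ricci_tab (amb_rho z) (fun k a c => dphi H h k a c z)
    (fun l k a c => ddphi H h l k a c z) (IU b) (IU d) =
  2 * amb_rho z * derive1n 2 (fun s => h b d s (amb_x z) (amb_u z)) (amb_rho z)
  + (2 - (q + (p + p))%:R)
    * derive1 (fun s => h b d s (amb_x z) (amb_u z)) (amb_rho z)
  - laplacian (fun x => H b d x (amb_u z) + h b d (amb_rho z) x (amb_u z))
      (amb_x z).
Proof.
move=> Wz; rewrite /ricci_tab !ddphi_Hh ?dphi_Hh// derive2_rho_Hh derive_rho_Hh.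
under eq_bigr do rewrite ddphi_Hh// derive2_x_Hh.
rewrite -mulr_sumr /laplacian.
move: (derive1n _ _ _) (derive1 _ _) (\sum_A _) => D2 D1 L.
by field.
Qed.

End WaveOperator.

(** * Regularity of the ambient metric, by pulling [H] and [h] back along projections *)

Section WaveRegularity.
Context {R : realType} {q p : nat}.
Local Notation m := (q + (p + p))%N.
Variables (U : set 'rV[R]_m) (eps : R) (r : option nat).
Variables (H : 'I_p -> 'I_p -> 'rV[R]_q -> 'rV[R]_p -> R).
Variables (h : 'I_p -> 'I_p -> R -> 'rV[R]_q -> 'rV[R]_p -> R).
Hypothesis U_open : open U.
Hypothesis H_smooth : forall a c, smooth (xu_proj U) (fun y => H a c y.1 y.2).
Hypothesis h_reg : forall a c,
  of_class r ([set rho : R | - eps < rho < eps] `*` xu_proj U)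
    (fun w : R * ('rV[R]_q * 'rV[R]_p) => h a c w.1 w.2.1 w.2.2).
Local Notation W := (amb_domain U eps).

Lemma amb_domain_xu z : W z -> xu_proj U (amb_xu z).
Proof. by move=> [_ [Uz _]]; exists (amb_base z). Qed.

Lemma of_class_H_amb a c : of_class r W (H_amb H a c).
Proof.
have := @of_class_comp_linear _ _ _
  (amb_xu : {linear 'rV[R]_(1 + (m + 1)) -> _})
  continuous_amb_xu r _ _ (smooth_of_class r (H_smooth a c)).
exact/of_class_sub/amb_domain_xu.
Qed.

Lemma of_class_h_amb a c : of_class r W (h_amb h a c).
Proof.
have := @of_class_comp_linear _ _ _
  (amb_rxu : {linear 'rV[R]_(1 + (m + 1)) -> _})
  continuous_amb_rxu r _ _ (h_reg a c).
apply: of_class_sub => z Wz; split; first by case: Wz => _ [].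
exact: amb_domain_xu.
Qed.

Lemma of_class_Hh_amb a c : of_class r W (Hh_amb H h a c).
Proof.
apply: of_class_add; [exact: open_amb_domain | exact: of_class_H_amb|].
exact: of_class_h_amb.
Qed.

Lemma of_class_phi a c : of_class r W (phi H h a c).
Proof.
by apply: of_class_add; first exact: open_amb_domain;
  apply: of_class_add; first [exact: open_amb_domain | exact: of_class_H_amb
  | exact: of_class_h_amb].
Qed.

Lemma of_class_gHh i j : of_class r W (fun z => gHh H h z i j).
Proof.
have Wo := open_amb_domain (eps := eps) U_open.
have Ct : of_class r W amb_t by apply: of_class_linear; exact: continuous_amb_t.
have Crho : of_class r W amb_rho.
  by apply: of_class_linear; exact: continuous_amb_rho.
have Ct2 : of_class r W (fun z => amb_t z ^+ 2) by exact: of_class_mul.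
rewrite -(idx_ofK i) -(idx_ofK j); move: (idx_of i) (idx_of j) => k l {i j}.
rewrite (_ : (fun z => _) = fun z => metric_tab (amb_t z) (amb_rho z)
  (fun a b => phi H h a b z) k l); last by apply/funext => z; exact: gHhE.
by case: k => [|A|a|a|]; case: l => [|B|b|b|] //=;
  first [exact: of_class_const | apply: of_class_mul => //;
    first [exact: of_class_const | exact: of_class_phi]].
Qed.

Lemma is_metric_gHh : is_metric r W (gHh H h).
Proof.
split=> [i j|z [t_gt0 _]]; first exact: of_class_gHh.
by split; [exact: gHh_sym | apply: gHh_unit; rewrite gt_eqF].
Qed.

End WaveRegularity.

(** * Ricci-flatness, the PDE and the ambient property *)

Theorem theorem2p1 (R : realType) (n p : nat)
    (hn : (2 <= n)%N) (hp : (1 <= p)%N) (hpn : (p.*2 <= n)%N)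
    (U : set 'rV[R]_(n - p.*2 + (p + p))) (U_open : open U)
    (eps : R) (eps_gt0 : 0 < eps)
    (H : 'I_p -> 'I_p -> 'rV[R]_(n - p.*2) -> 'rV[R]_p -> R)
    (H_smooth : forall a c, smooth (xu_proj U) (fun y => H a c y.1 y.2))
    (H_sym : forall a c y, xu_proj U y -> H a c y.1 y.2 = H c a y.1 y.2)
    (r : option nat) (hr : at_least_C2 r)
    (h : 'I_p -> 'I_p -> R -> 'rV[R]_(n - p.*2) -> 'rV[R]_p -> R)
    (h_reg : forall a c,
      of_class r ([set rho : R | - eps < rho < eps] `*` xu_proj U)
        (fun w : R * ('rV[R]_(n - p.*2) * 'rV[R]_p) => h a c w.1 w.2.1 w.2.2))
    (h_sym : forall a c rho y, - eps < rho < eps -> xu_proj U y ->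
      h a c rho y.1 y.2 = h c a rho y.1 y.2) :
  let PDE := forall b d rho x u, - eps < rho < eps -> xu_proj U (x, u) ->
    2 * rho * derive1n 2 (fun s => h b d s x u) rho
    + (2 - n%:R) * derive1 (fun s => h b d s x u) rho
    - laplacian (fun x' => H b d x' u + h b d rho x' u) x = 0 in
  (ricci_flat (amb_domain U eps) (gHh H h) <-> PDE) /\
  (PDE ->
   (forall b d y, xu_proj U y -> h b d 0 y.1 y.2 = 0) ->
   ambient_metric r U eps (gH H) (gHh H h)).
Proof.
move=> PDE.
set q := (n - p.*2)%N in U U_open H H_smooth H_sym h h_reg h_sym PDE *.
pose W := amb_domain U eps.
have W_open : open W := open_amb_domain U_open.
have W_t z : W z -> amb_t z != 0 by move=> [t_gt0 _]; rewrite gt_eqF.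
have C2 f : of_class r W f -> Ck 2 W f.
  by apply: of_class_Ck; case: (r) hr.
have phi_C2 a b : Ck 2 W (phi H h a b).
  by apply: C2; exact: of_class_phi.
have Hh_C2 a b : Ck 2 W (Hh_amb H h a b).
  by apply: C2; exact: of_class_Hh_amb.
have Hh_sym b d z : W z -> Hh_amb H h b d z = Hh_amb H h d b z.
  move=> Wz; have [_ [_ rho_eps]] := Wz.
  have := amb_domain_xu Wz; rewrite /Hh_amb => xuz.
  by congr (_ + _);
    [exact: (H_sym b d) xuz | exact: (h_sym b d _ _ rho_eps) xuz].
have ricciE b d z : W z -> ricci (gHh H h) (ord_of (IU b)) (ord_of (IU d)) z =
    2 * amb_rho z
      * derive1n 2 (fun s => h b d s (amb_x z) (amb_u z)) (amb_rho z)
    + (2 - n%:R) * derive1 (fun s => h b d s (amb_x z) (amb_u z)) (amb_rho z)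
    - laplacian (fun x => H b d x (amb_u z) + h b d (amb_rho z) x (amb_u z))
        (amb_x z).
  move=> Wz; rewrite (ricci_gHh W_open W_t phi_C2)//.
  rewrite (ricci_tab_Hh W_open Hh_C2)//.
  (* The table has the base dimension q + 2p, which is n because 2p <= n. *)
  by congr (_ + (_ - _%:R) * _ - _); exact: base_dimE.
have flat : ricci_flat W (gHh H h) <-> PDE.
  split=> [flat b d rho x u rho_eps [y Uy [<- <-]]|pde z Wz i j].
    (* Each (rho, x, u) in the domain of the PDE lies under an ambient point: take t = 1 and, for v,
       the fibre coordinate of a point [y] of [U] over (x, u). *)
    have [z [Wz zrho zy]] : exists z,
        [/\ W z, amb_rho z = rho & amb_base z = y].
      pose z : 'rV[R]_(1 + (q + (p + p) + 1)) := row_mx 1 (row_mx y rho%:M).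
      have zt : amb_t z = 1 by rewrite /amb_t row_mxEl mxE.
      have zrho : amb_rho z = rho by rewrite /amb_rho !row_mxEr mxE.
      have zy : amb_base z = y by rewrite /amb_base row_mxKr row_mxKl.
      by exists z; split=> //; split; rewrite ?zt ?zrho ?zy.
    by rewrite -zrho -zy -[LHS](ricciE b d z Wz) flat.
  rewrite -(idx_ofK i) -(idx_ofK j).
  have [_ [_ rho_eps]] := Wz.
  (* All components other than u-u vanish by the table, independently of the PDE. *)
  case: (idx_of i) => [|A|b|a|]; case: (idx_of j) => [|B|d|c|];
    try by rewrite (ricci_gHh W_open W_t phi_C2).
  by rewrite ricciE//; apply: pde => //; exact: (amb_domain_xu Wz).
split=> // pde h0; split; [exact: is_metric_gHh| |exact/flat].
(* This is the family from which [gHh] is built by [amb_form], so only the value at rho = 0 has to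
   be checked; there the initial condition removes every term in [h]. *)
exists (fun rho y => gH H y + 2 *: (\sum_(a < p) \sum_(c < p)
    h a c rho (xpart y) (upart y) *: (du a ⊙ du c))) => // y Uy.
rewrite big1 ?scaler0 ?addr0// => a _; rewrite big1// => c _.
by rewrite (h0 a c (xpart y, upart y)) ?scale0r//; exists y.
Qed.
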